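(* Let $ABC$ be a nondegenerate triangle with incenter $I$. If an admissible pair of cevians $BB_A, CC_A$ has Miquel–Steiner point $M_A=I$, then $|BC_A|=|CB_A|=|BC|$.
   Context: Work in the Euclidean plane with a nondegenerate triangle $ABC$. An admissible pair of cevians consists of lines $BB_A$ and $CC_A$, where $B_A$ is a point of line $AC$ with $B_A\neq A, C$, and $C_A$ is a point of line $AB$ with $C_A\neq A, B$ (the points may lie outside the sides), such that $BB_A$ and $CC_A$ are not parallel. Let $N_A$ be the intersection point of $BB_A$ and $CC_A$. The circumcircles of the four triangles $ABB_A$, $ACC_A$, $CB_AN_A$, $BC_AN_A$ have a unique common point $M_A$, called the Miquel–Steiner point of triangle $ABC$ with cevians $BB_A, CC_A$ (equivalently, $M_A$ is the common point other than $A$ of the circumcircles of $ABB_A$ and $ACC_A$). *)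

(* Defs.v *)
From mathcomp Require Import all_boot all_order all_algebra.
From mathcomp Require Import reals.

Set Implicit Arguments.
Unset Strict Implicit.
Unset Printing Implicit Defensive.

Import Order.TTheory GRing.Theory Num.Theory.
Local Open Scope ring_scope.

(* Points of the Euclidean plane are row vectors 'rV[R]_2. *)

Definition dist (R : realType) (P Q : 'rV[R]_2) : R :=
  Num.sqrt (\sum_(i < 2) (P 0 i - Q 0 i) ^+ 2).

(* This is the line PQ only when P <> Q; otherwise it is the single point P. *)
Definition on_line (R : realType) (P Q X : 'rV[R]_2) : Prop :=
  exists t : R, X = P + t *: (Q - P).

Definition on_segment (R : realType) (P Q X : 'rV[R]_2) : Prop :=
  exists t : R, 0 <= t <= 1 /\ X = P + t *: (Q - P).

(* The first disjunct is needed because on_line P P is a single point. *)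
Definition collinear (R : realType) (P Q S : 'rV[R]_2) : Prop :=
  P = Q \/ on_line P Q S.

Definition nondegenerate_triangle (R : realType) (A B C : 'rV[R]_2) : Prop :=
  ~ collinear A B C.

(* Lines PQ and ST, for P <> Q and S <> T. *)
Definition parallel (R : realType) (P Q S T : 'rV[R]_2) : Prop :=
  exists k : R, T - S = k *: (Q - P).

(* The circle of centre O and radius r meets the line PQ in exactly one point,
   and this point lies on the segment PQ (which rules out the excircles when
   imposed on all three sides of a triangle). *)
Definition tangent_to_side (R : realType) (O : 'rV[R]_2) (r : R)
    (P Q : 'rV[R]_2) : Prop :=
  exists D, [/\ on_segment P Q D, dist O D = r
    & forall X, on_line P Q X -> dist O X = r -> X = D].

Definition is_incenter (R : realType) (A B C I : 'rV[R]_2) : Prop :=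
  exists r : R, [/\ 0 < r, tangent_to_side I r B C,
    tangent_to_side I r C A & tangent_to_side I r A B].

(* For non-collinear P, Q, S the circle is unique; for three distinct collinear
   points there is none. *)
Definition on_circumcircle (R : realType) (P Q S X : 'rV[R]_2) : Prop :=
  exists (O : 'rV[R]_2) (r : R),
    [/\ dist O P = r, dist O Q = r, dist O S = r & dist O X = r].

Definition admissible (R : realType) (A B C BA CA : 'rV[R]_2) : Prop :=
  [/\ on_line A C BA /\ (BA <> A /\ BA <> C),
      on_line A B CA /\ (CA <> A /\ CA <> B)
    & ~ parallel B BA C CA].

(* M is a common point of the four circumcircles, N being the intersection of
   the two cevians.  For an admissible pair such a point is unique: the circles
   of A B BA and A C CA meet in at most one point other than A, and A is not on
   the circle of C BA N.  Hence uniqueness is not repeated here. *)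
Definition is_miquel_steiner (R : realType) (A B C BA CA M : 'rV[R]_2) : Prop :=
  exists N : 'rV[R]_2,
    (on_line B BA N /\ on_line C CA N) /\
    [/\ on_circumcircle A B BA M, on_circumcircle A C CA M,
        on_circumcircle C BA N M & on_circumcircle B CA N M].

(* Main.v *)
Require Import Defs.
From mathcomp Require Import all_boot all_order all_algebra.
From mathcomp Require Import reals.
From mathcomp Require Import ring lra.

(** Write [a], [b], [c] for the side lengths and [x] for the tangent length from
    [A] to the incircle, so that [2 x = b + c - a].  The incenter [I] lies on the
    bisector direction [b (B - A) + c (C - A)].  Pairing this direction with the
    vector from [A] to the centre of the circle through [A], [B],
    [BA = A + t (C - A)] and [I] gives [c + t b = 2 x].  Hence [t b = b - a], and
    [|C BA| = |1 - t| b = a].  The other equality follows by exchanging the roles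
    of [B] and [C]. *)

Set Implicit Arguments.
Unset Strict Implicit.
Unset Printing Implicit Defensive.

Import Order.TTheory GRing.Theory Num.Theory.
Local Open Scope ring_scope.

Section PlaneGeometry.
Variable R : realType.
Implicit Types (P Q S T O D I A B C X u v w d p o : 'rV[R]_2) (r t x : R).

(** * Dot and cross products in coordinates *)

Definition dot u v : R := u 0 0 * v 0 0 + u 0 1 * v 0 1.
Definition cross u v : R := u 0 0 * v 0 1 - u 0 1 * v 0 0.

Lemma rV2P u v : u 0 0 = v 0 0 -> u 0 1 = v 0 1 -> u = v.
Proof.
move=> h0 h1; apply/rowP => i.
case: (unliftP 0 i) => [j ->|-> //].
by rewrite (_ : lift 0 j = 1) //; apply: val_inj; rewrite /= ord1.
Qed.

Lemma dotvv_eq0 u : dot u u = 0 -> u = 0.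
Proof. by rewrite /dot => h; apply: rV2P; rewrite mxE; nra. Qed.

Lemma dotvv_neq0 u : u <> 0 -> dot u u != 0.
Proof. by move=> h; apply/eqP => /dotvv_eq0. Qed.

Lemma cross_neq0l u v : cross u v <> 0 -> u <> 0.
Proof. by move=> h u0; apply: h; rewrite /cross u0 !mxE; ring. Qed.

Lemma cross_neq0r u v : cross u v <> 0 -> v <> 0.
Proof. by move=> h v0; apply: h; rewrite /cross v0 !mxE; ring. Qed.

Lemma dist_ge0 P Q : 0 <= dist P Q.
Proof. exact: sqrtr_ge0. Qed.

Lemma sqr_dist P Q : dist P Q ^+ 2 = dot (P - Q) (P - Q).
Proof.
rewrite /dist sqr_sqrtr; last by apply: sumr_ge0 => i _; exact: sqr_ge0.
rewrite !big_ord_recl big_ord0 /dot !mxE.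
by rewrite (_ : lift ord0 ord0 = 1) ?addr0 ?expr2 //; apply: val_inj.
Qed.

Lemma dist_eq P Q r : 0 <= r -> dot (P - Q) (P - Q) = r ^+ 2 -> dist P Q = r.
Proof.
move=> r0; rewrite -sqr_dist => /eqP.
by rewrite eqrXn2 // ?dist_ge0 // => /eqP.
Qed.

Lemma distC P Q : dist P Q = dist Q P.
Proof. by apply: dist_eq; rewrite ?dist_ge0 // sqr_dist /dot !mxE; ring. Qed.

Lemma dist_gt0 P Q : P <> Q -> 0 < dist P Q.
Proof.
move=> h; rewrite lt_neqAle dist_ge0 andbT; apply/eqP => h0; apply: h.
by apply/subr0_eq/dotvv_eq0; rewrite -sqr_dist -h0 expr0n.
Qed.

Lemma cross_triangle A B C :
  nondegenerate_triangle A B C -> cross (B - A) (C - A) <> 0.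
Proof.
move=> h c0; apply: h.
case: (eqVneq A B) => [|/eqP nAB]; [by left | right].
have u0 : dot (B - A) (B - A) != 0.
  by apply: dotvv_neq0 => /subr0_eq e; apply: nAB.
(* The witness is the parameter of the orthogonal projection of [C] onto [AB]. For [u = B - A],
   [v = C - A], the vector [|u|^2 v - (u.v) u] is [cross u v] times the quarter turn of [u], so it
   vanishes. *)
exists (dot (B - A) (C - A) / dot (B - A) (B - A)).
have et := divfK u0 (dot (B - A) (C - A)).
set t := _ / _ in et *.
apply: rV2P; apply: (mulIf u0); apply/eqP; rewrite -subr_eq0; apply/eqP.
- transitivity (- (B - A) 0 1 * cross (B - A) (C - A) - (B - A) 0 0 *
    (t * dot (B - A) (B - A) - dot (B - A) (C - A))).
    by rewrite /cross /dot !mxE; ring.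
  by rewrite c0 et subrr !mulr0 subrr.
- transitivity ((B - A) 0 0 * cross (B - A) (C - A) - (B - A) 0 1 *
    (t * dot (B - A) (B - A) - dot (B - A) (C - A))).
    by rewrite /cross /dot !mxE; ring.
  by rewrite c0 et subrr !mulr0 subrr.
Qed.

(** * Tangent lengths of the incircle *)

(* The reflection of the contact point in the foot of the perpendicular from [O]
   also lies on the circle and on the line, so the contact point is that foot. *)
Lemma tangent_contact_foot O r P Q : P <> Q -> tangent_to_side O r P Q ->
  exists s, [/\ 0 <= s <= 1,
    dot (O - P) (Q - P) = s * dist P Q ^+ 2,
    (s * dist P Q) ^+ 2 + r ^+ 2 = dist P O ^+ 2 &
    ((1 - s) * dist P Q) ^+ 2 + r ^+ 2 = dist Q O ^+ 2].
Proof.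
move=> nPQ [D [[s [s01 eD]] rD uD]]; exists s.
have q0 : dot (Q - P) (Q - P) != 0.
  by apply: dotvv_neq0 => /subr0_eq e; apply: nPQ.
(* [f] is the parameter of the foot of the perpendicular from [O], so [2 * f - s] is the parameter
   of the reflected contact point. *)
set f := dot (O - P) (Q - P) / dot (Q - P) (Q - P).
have ef : dot (O - P) (Q - P) = f * dot (Q - P) (Q - P) by rewrite /f divfK.
have rge : 0 <= r by rewrite -rD dist_ge0.
have rD2 : dot (O - D) (O - D) = r ^+ 2 by rewrite -rD sqr_dist.
have eX : P + (2 * f - s) *: (Q - P) = D.
  apply: uD; first by exists (2 * f - s).
  apply: dist_eq => //; rewrite -rD2 eD.
  apply/eqP; rewrite -subr_eq0; apply/eqP.
  transitivity (4 * (s - f) *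
    (dot (O - P) (Q - P) - f * dot (Q - P) (Q - P))).
    by rewrite /dot !mxE; ring.
  by rewrite ef subrr mulr0.
have sf : s = f.
  have : (2 * (f - s)) * dot (Q - P) (Q - P) = 0.
    transitivity (dot (P + (2 * f - s) *: (Q - P) - D) (Q - P)).
      by rewrite eD /dot !mxE; ring.
    by rewrite eX subrr /dot !mxE; ring.
  by move=> /eqP; rewrite mulf_eq0 (negbTE q0) orbF => /eqP; lra.
have esq : dist P Q ^+ 2 = dot (Q - P) (Q - P) by rewrite distC sqr_dist.
have eo : dot (O - P) (Q - P) = s * dist P Q ^+ 2 by rewrite esq sf.
(* Pythagoras at [P] and at [Q]: in each case the error term is a multiple of the perpendicularity
   relation [eo]. *)
split => //; rewrite exprMn esq -rD2 distC sqr_dist.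
  transitivity (dot (O - P) (O - P) -
    2 * s * (dot (O - P) (Q - P) - s * dot (Q - P) (Q - P))).
    by rewrite eD /dot !mxE; ring.
  by rewrite eo esq subrr mulr0 subr0.
transitivity (dot (O - Q) (O - Q) +
  2 * (1 - s) * (dot (O - P) (Q - P) - s * dot (Q - P) (Q - P))).
  by rewrite eD /dot !mxE; ring.
by rewrite eo esq subrr mulr0 addr0.
Qed.

(** [x] and [y] are the distances from the contact point to [P] and [Q]; they add up to [|PQ|]
    because that point lies on the segment. *)
Lemma tangent_lengths O r P Q : P <> Q -> tangent_to_side O r P Q ->
  exists x y, [/\ 0 <= x, 0 <= y, x + y = dist P Q,
    x ^+ 2 + r ^+ 2 = dist P O ^+ 2 & y ^+ 2 + r ^+ 2 = dist Q O ^+ 2] /\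
    dot (O - P) (Q - P) = x * dist P Q /\ dot (O - Q) (P - Q) = y * dist P Q.
Proof.
move=> nPQ /(tangent_contact_foot nPQ) [s [/andP[s0 s1] e1 e2 e3]].
exists (s * dist P Q), ((1 - s) * dist P Q).
have d0 := dist_ge0 P Q.
split; first split => //; try by rewrite mulr_ge0 // subr_ge0.
  by ring.
split; first by rewrite e1; ring.
have := sqr_dist Q P; rewrite (distC Q P) => e4.
transitivity (dot (Q - P) (Q - P) - dot (O - P) (Q - P)).
  by rewrite /dot !mxE; ring.
by rewrite e1 -e4; ring.
Qed.

Lemma sqrD_inj x y r : 0 <= x -> 0 <= y ->
  x ^+ 2 + r ^+ 2 = y ^+ 2 + r ^+ 2 -> x = y.
Proof.
by move=> x0 y0 /addIr /eqP; rewrite eqrXn2 // => /eqP.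
Qed.

(** At each vertex the two tangent lengths are nonnegative with the same square, hence equal. The
    equal projections [x] of [I - A] on both sides encode the bisector. *)
Lemma incenter_tangent_length A B C I :
  nondegenerate_triangle A B C -> is_incenter A B C I ->
  exists x, [/\ I <> A, 2 * x = dist A C + dist A B - dist B C,
    dot (I - A) (B - A) = x * dist A B & dot (I - A) (C - A) = x * dist A C].
Proof.
move=> /cross_triangle cABC [r [r0 tBC tCA tAB]].
have nAB : A <> B.
  by move=> e; apply: (cross_neq0l cABC); rewrite e subrr.
have nCA : C <> A.
  by move=> e; apply: (cross_neq0r cABC); rewrite e subrr.
have nBC : B <> C.
  by move=> e; apply: cABC; rewrite e /cross; ring.
have [y1 [z1 [[y10 z10 e1 ey1 ez1] _]]] := tangent_lengths nBC tBC.
have [z2 [x2 [[z20 x20 e2 ez2 ex2] [_ d2]]]] := tangent_lengths nCA tCA.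
have [x3 [y3 [[x30 y30 e3 ex3 ey3] [d3 _]]]] := tangent_lengths nAB tAB.
have ex : x2 = x3 by apply: (@sqrD_inj _ _ r) => //; rewrite ex2 ex3.
have ey : y1 = y3 by apply: (@sqrD_inj _ _ r) => //; rewrite ey1 ey3.
have ez : z1 = z2 by apply: (@sqrD_inj _ _ r) => //; rewrite ez1 ez2.
exists x3; split => //.
(* If [I = A], then [x3 ^+ 2 + r ^+ 2 = 0], against [0 < r]. *)
- move=> eI; move: ex3; rewrite eI (sqr_dist A A) subrr /dot !mxE; nra.
- by rewrite (distC A C) -e1 -e2 -e3 ex ey ez; ring.
- by rewrite d2 ex (distC A C).
Qed.

(** * The circle through [A], [B], the cevian foot and the incenter *)

(** In the plane, [w] and [p] are parallel, both being orthogonal to [d]; the difference of the two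
    sides is [cross w p * cross w o] by Lagrange's identity. *)
Lemma dot_parallel d w p o : d <> 0 -> dot d w = 0 -> dot d p = 0 ->
  dot w w * dot o p = dot o w * dot w p.
Proof.
move=> d0 dw dp.
have cwp : cross w p = 0.
  apply: (mulfI (dotvv_neq0 d0)); rewrite mulr0.
  transitivity (dot d w * cross d p - dot d p * cross d w).
    by rewrite /dot /cross; ring.
  by rewrite dw dp !mul0r subrr.
apply/eqP; rewrite -subr_eq0; apply/eqP.
transitivity (cross w p * cross w o); first by rewrite /dot /cross; ring.
by rewrite cwp mul0r.
Qed.

Lemma dot_equidistant O A P : dist O A = dist O P ->
  2 * dot (O - A) (P - A) = dot (P - A) (P - A).
Proof.
move=> e; have : dist O A ^+ 2 = dist O P ^+ 2 by rewrite e.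
by rewrite !sqr_dist /dot !mxE; lra.
Qed.

Lemma circle_bisector_chord A B C I x t :
  cross (B - A) (C - A) <> 0 -> I <> A ->
  dot (I - A) (B - A) = x * dist A B -> dot (I - A) (C - A) = x * dist A C ->
  t != 0 -> on_circumcircle A B (A + t *: (C - A)) I ->
  t * dist A C + dist A B = 2 * x.
Proof.
move=> cABC nIA eB eC t0 [O [r [rA rB rT rI]]].
set u := B - A in cABC eB *; set v := C - A in cABC eC rT *.
set w := I - A in eB eC *; set o := O - A.
have := sqr_dist B A; rewrite (distC B A) -/u => eb.
have := sqr_dist C A; rewrite (distC C A) -/v => ec.
have b0 : 0 < dist A B.
  apply: dist_gt0 => e; apply: (cross_neq0l cABC).
  by rewrite /u e subrr.
have c0 : 0 < dist A C.
  apply: dist_gt0 => e; apply: (cross_neq0r cABC).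
  by rewrite /v e subrr.
set c := dist A B in eB eb b0 *; set b := dist A C in eC ec c0 *.
have ou : 2 * dot o u = c ^+ 2 by rewrite eb; apply: dot_equidistant; rewrite rA.
have ow : 2 * dot o w = dot w w by apply: dot_equidistant; rewrite rA.
(* The chord is [t *: v], so equidistance gives this relation multiplied by [t], which is
   nonzero. *)
have ov : 2 * dot o v = t * b ^+ 2.
  have : dist O A = dist O (A + t *: v) by rewrite rA.
  move/dot_equidistant; rewrite addrAC subrr add0r -/o => e.
  apply: (mulfI t0); rewrite ec.
  transitivity (2 * dot o (t *: v)); first by rewrite /dot !mxE; ring.
  by rewrite e /dot !mxE; ring.
have w0 : dot w w != 0 by apply: dotvv_neq0 => /subr0_eq.
(* [b *: u] and [c *: v] have the same length [b * c], so their sum and difference are the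
   orthogonal diagonals of a rhombus: the sum spans the bisector at [A], the difference is normal to
   it. *)
have d0 : b *: u - c *: v <> 0.
  move=> e; apply: cABC; apply: (mulfI (lt0r_neq0 c0)).
  transitivity (cross (b *: u - c *: v) v); first by rewrite /cross !mxE; ring.
  by rewrite e mulr0 /cross !mxE; ring.
have dw : dot (b *: u - c *: v) w = 0.
  transitivity (b * dot w u - c * dot w v); first by rewrite /dot !mxE; ring.
  by rewrite eB eC; ring.
have dp : dot (b *: u - c *: v) (b *: u + c *: v) = 0.
  transitivity (b ^+ 2 * dot u u - c ^+ 2 * dot v v).
    by rewrite /dot !mxE; ring.
  by rewrite -eb -ec; ring.
have := dot_parallel o d0 dw dp.
have -> : dot o (b *: u + c *: v) = b * dot o u + c * dot o v.
  by rewrite /dot !mxE; ring.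
have -> : dot w (b *: u + c *: v) = b * dot w u + c * dot w v.
  by rewrite /dot !mxE; ring.
rewrite eB eC => e.
have bc0 : dot w w * (b * c) != 0.
  by apply: mulf_neq0 => //; rewrite mulf_eq0 !gt_eqF.
apply: (mulfI bc0).
transitivity (2 * (dot w w * (b * dot o u + c * dot o v))).
  transitivity (dot w w * (b * (2 * dot o u) + c * (2 * dot o v))).
    by rewrite ou ov; ring.
  by ring.
rewrite e -ow; ring.
Qed.

Lemma dist_cevian_foot A B C I T :
  nondegenerate_triangle A B C -> is_incenter A B C I ->
  on_line A C T -> T <> A -> on_circumcircle A B T I ->
  dist C T = dist B C.
Proof.
move=> hABC hI [t ->] nTA hT.
have [x [nIA ex eB eC]] := incenter_tangent_length hABC hI.
have t0 : t != 0 by apply/eqP => e; apply: nTA; rewrite e scale0r addr0.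
have := circle_bisector_chord (cross_triangle hABC) nIA eB eC t0 hT.
rewrite ex => e.
apply: dist_eq; first exact: dist_ge0.
(* This compares [t b + c = 2 x] with [2 x = b + c - a]. No absolute value of [1 - t] appears, since
   [(1 - t) b] equals the distance [a]. *)
have -> : dist B C = (1 - t) * dist A C by lra.
rewrite exprMn distC sqr_dist /dot !mxE; ring.
Qed.

(** * Exchange of [B] and [C] *)

(** [is_incenter] runs through the sides cyclically, so exchanging [B] and [C] reverses every
    side. *)
Lemma tangent_to_sideC O r P Q : tangent_to_side O r P Q -> tangent_to_side O r Q P.
Proof.
have rev X Y t : X + t *: (Y - X) = Y + (1 - t) *: (X - Y).
  by apply: rV2P; rewrite !mxE; ring.
move=> [D [[t [/andP[t0 t1] ->]] rD uD]].
exists (P + t *: (Q - P)); split => //.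
  by exists (1 - t); split; [lra | exact: rev].
by move=> X [s ->]; rewrite rev => rX; apply: uD => //; exists (1 - s).
Qed.

Lemma is_incenter_swap A B C I : is_incenter A B C I -> is_incenter A C B I.
Proof. by move=> [r [r0 h1 h2 h3]]; exists r; split => //; exact: tangent_to_sideC. Qed.

Lemma nondegenerate_swap A B C :
  nondegenerate_triangle A B C -> nondegenerate_triangle A C B.
Proof.
move=> /cross_triangle h hc; apply: h.
case: hc => [->|[t ->]]; rewrite /cross !mxE; ring.
Qed.

End PlaneGeometry.

Theorem mainTheorem5 (R : realType) (A B C I BA CA : 'rV[R]_2)
  (hABC : nondegenerate_triangle A B C)
  (hI : is_incenter A B C I)
  (hadm : admissible A B C BA CA)
  (hM : is_miquel_steiner A B C BA CA I) :
  dist B CA = dist B C /\ dist C BA = dist B C.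
Proof.
case: hadm => [[lBA [nBA _]] [lCA [nCA _]] _].
case: hM => N [_ [cB cC _ _]].
split; last exact: (dist_cevian_foot hABC hI).
rewrite (distC B C).
exact: (dist_cevian_foot (nondegenerate_swap hABC) (is_incenter_swap hI)).
Qed.
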